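(* Let $m\ge 1$ and let $P\in\mathbb{C}[x]$ be a monic polynomial of degree $m$ with $P(n)\neq 0$ for all $n\in\mathbb{Z}$. Suppose that the associated matrix $C(P)$ is non-degenerate (invertible) and that the series $$\sum_{n\in\mathbb{Z}}\frac{n^k}{P(n)},\qquad \sum_{n\in\mathbb{Z}}(-1)^n\frac{n^k}{P(n)},\qquad k=0,1,\dots,m-1,$$ converge. Then the values of these series lie in the field $$\mathbb{Q}(i,\pi,\mathcal{R},\mathcal{E})\subseteq\mathbb{C},$$ where $\mathcal{R}$ is the set of roots of $P$ and $\mathcal{E}=\{e^{-ir\pi}: r\in\mathcal{R}\}$; and an explicit expression for each of them as an element of this field can be found.
   Context: Two-sided series are understood as limits of symmetric partial sums: $\sum_{n\in\mathbb{Z}}u_n=\lim_{N\to\infty}\sum_{n=-N}^{N}u_n$, and $n^0=1$ for all $n$, including $n=0$. Let $r_1,\dots,r_m\in\mathbb{C}$ be the roots of the monic polynomial $P$ of degree $m$, listed with multiplicity. For $l\in\{1,\dots,m-1\}$ and $j\in\{1,\dots,m\}$ put $$T^P_{l,j}=\sum_{\substack{A\subseteq\{1,\dots,m\}\\ |A|=l,\ j\in A}}\ \prod_{s\in A}r_s,$$ and put $T^P_{0,j}=1$. The associated matrix of $P$ is the $m\times m$ complex matrix $C(P)=(C_{l,k})_{0\le l,k\le m-1}$ whose entries are determined by the polynomial identities $$\sum_{k=0}^{m-1}C_{l,k}\,x^k=\frac{1}{2\pi i}\sum_{j=1}^{m}T^P_{l,j}\prod_{\substack{1\le s\le m\\ s\ne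 j}}(x-r_s),\qquad l=0,\dots,m-1.$$ Equivalently, $\frac{1}{2\pi i}\sum_{j=1}^m \frac{T^P_{l,j}}{n-r_j}=\sum_{k=0}^{m-1}\frac{C_{l,k}n^k}{P(n)}$ for all integers $n$. *)

(* Defs.v *)
From HB Require Import structures.
From mathcomp Require Import all_boot all_order all_algebra.
From mathcomp Require Import complex.
From mathcomp Require Import all_classical all_reals all_analysis.

Set Implicit Arguments.
Unset Strict Implicit.
Unset Printing Implicit Defensive.

Import Order.TTheory GRing.Theory Num.Theory numFieldNormedType.Exports.
Local Open Scope classical_set_scope.
Local Open Scope ring_scope.
Local Open Scope complex_scope.

Section Complex.
Variable R : realType.
Local Notation C := R[i].

Definition piC : C := (pi : R)%:C.

(* e^(x + iy) = e^x (cos y + i sin y) *)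
Definition expC (z : C) : C :=
  (expR (complex.Re z))%:C * (cos (complex.Im z) +i* sin (complex.Im z)).

(* Two-sided series are limits of symmetric partial sums. The regular module
   C^o carries the topology given by the modulus. *)
Definition zpartial (u : int -> C) : nat -> C^o :=
  fun N => \sum_(j < N.*2.+1) u (j%:Z - N%:Z).

Definition zsummable (u : int -> C) : Prop := cvgn (zpartial u).

Definition zsum (u : int -> C) : C := limn (zpartial u).

Definition zterm (P : {poly C}) (k : nat) (n : int) : C :=
  n%:~R ^+ k / P.[n%:~R].

Definition zterm_alt (P : {poly C}) (k : nat) (n : int) : C :=
  (-1) ^ n * zterm P k n.

(* The subfield of C generated by S; a subfield contains the rationals. *)
Definition gen_subfield (S : set C) : set C :=
  smallest [set K : set C | divring_closed (mem K)] S.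

(* Q(i, pi, R, E) with R the set of roots of P and E = {e^(-i r pi) : r in R} *)
Definition series_field (P : {poly C}) : set C :=
  gen_subfield ([set 'i; piC] `|` [set x | root P x]
                `|` [set expC (- ('i * x * piC)) | x in [set x | root P x]]).

Section Roots.
Variables (m : nat) (r : 'I_m -> C).

Definition rootT (l : nat) (j : 'I_m) : C :=
  if l is 0%N then 1
  else \sum_(A : {set 'I_m} | (#|A| == l) && (j \in A)) \prod_(s in A) r s.

(* The polynomial whose coefficients form the l-th row of the associated
   matrix; its degree is at most m - 1. *)
Definition assoc_row (l : nat) : {poly C} :=
  (2 * piC * 'i)^-1 *:
    \sum_(j < m) rootT l j *: \prod_(s < m | s != j) ('X - (r s)%:P).

Definition assoc_matrix : 'M[C]_m := \matrix_(l, k) (assoc_row l)`_k.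

End Roots.
End Complex.

(* Formal field expressions in i, pi, the listed roots r_j and the numbers
   e^(-i r_j pi), with rational constants. *)
Inductive fexpr (m : nat) : Type :=
| FRat of rat
| FI
| FPi
| FRoot of 'I_m
| FExp of 'I_m
| FAdd of fexpr m & fexpr m
| FOpp of fexpr m
| FMul of fexpr m & fexpr m
| FInv of fexpr m.

Section Eval.
Variables (R : realType) (m : nat) (r : 'I_m -> R[i]).

Fixpoint feval (e : fexpr m) : R[i] :=
  match e with
  | FRat q => ratr q
  | FI => 'i
  | FPi => piC R
  | FRoot j => r j
  | FExp j => expC (- ('i * r j * piC R))
  | FAdd e1 e2 => feval e1 + feval e2
  | FOpp e1 => - feval e1
  | FMul e1 e2 => feval e1 * feval e2
  | FInv e1 => (feval e1)^-1
  end.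

(* No inversion of zero occurs, so the convention 0^-1 = 0 is never used. *)
Fixpoint fdefined (e : fexpr m) : Prop :=
  match e with
  | FAdd e1 e2 | FMul e1 e2 => fdefined e1 /\ fdefined e2
  | FOpp e1 => fdefined e1
  | FInv e1 => fdefined e1 /\ feval e1 != 0
  | _ => True
  end.

End Eval.

(* Main.v *)
Require Import Defs.
From HB Require Import structures.
From mathcomp Require Import all_boot all_order all_algebra.
From mathcomp Require Import complex.
From mathcomp Require Import all_classical all_reals all_analysis.
From mathcomp Require Import ring lra zify.

Set Implicit Arguments.
Unset Strict Implicit.
Unset Printing Implicit Defensive.

Import Order.TTheory GRing.Theory Num.Theory numFieldNormedType.Exports.
Local Open Scope classical_set_scope.
Local Open Scope ring_scope.
Local Open Scope complex_scope.

(** A repeated root would be a common zero of all row polynomials of the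
    associated matrix, so its powers would span a kernel: the roots are distinct.
    Partial fractions then reduce every series to the symmetric sums of
    1/(n - r) and (-1)^n/(n - r) over the roots r, whose values are
    - pi cot(pi r) and - pi / sin(pi r), rational expressions in i, pi and
    e^(- i r pi).

    The cotangent expansion comes from iterating the duplication formula
    2 cot(2x) = cot x + cot(x + pi/2): pi cot(pi z) is the average of
    pi cot(pi (z + k) / 2^p) over k modulo 2^p. For fixed N, the terms with
    |k| <= N tend to the partial sum of 1/(z + k) as p grows; pairing k with - k,
    the remaining pairs add up to at most a multiple of the sum of 1/k^2 over
    k > N, hence of 1/N, uniformly in p, and the unpaired middle term tends to 0.
    The alternating series is twice the series over even n minus the full one. *)

Section CotangentSeries.
Variable R : realType.
Local Notation C := R[i].
Local Notation normc := (@Normc.normc R).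

(** * The exponential e^(2 pi i w) *)

Lemma expC0 : expC (0 : C) = 1.
Proof. by rewrite /expC /= expR0 cos0 sin0 mul1r. Qed.

Lemma expCD (x y : C) : expC (x + y) = expC x * expC y.
Proof.
case: x y => [a b] [c d]; rewrite /expC /= expRD cosD sinD.
by apply/eqP; rewrite eq_complex /=; apply/andP; split; apply/eqP; ring.
Qed.

Lemma expC_neq0 (x : C) : expC x != 0.
Proof.
apply/eqP => x0; have := expC0; rewrite -(subrr x) expCD x0 mul0r.
by apply/eqP; rewrite eq_sym oner_eq0.
Qed.

Definition exp2pi (w : C) : C := expC ('i * w * (2 * piC R)).

Lemma exp2piE (a b : R) :
  exp2pi (a +i* b) = (expR (- (b * (2 * pi))))%:C
                     * (cos (a * (2 * pi)) +i* sin (a * (2 * pi))).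
Proof.
by rewrite /exp2pi /expC /piC /=; congr (_%:C * (_ +i* _));
  [congr expR | congr cos | congr sin]; ring.
Qed.

Lemma exp2piD (x y : C) : exp2pi (x + y) = exp2pi x * exp2pi y.
Proof. by rewrite /exp2pi -expCD; congr expC; ring. Qed.

Lemma exp2pi_neq0 (x : C) : exp2pi x != 0.
Proof. exact: expC_neq0. Qed.

Lemma exp2pi0 : exp2pi 0 = 1.
Proof. by rewrite /exp2pi mulr0 mul0r expC0. Qed.

Lemma exp2piN (x : C) : exp2pi (- x) = (exp2pi x)^-1.
Proof.
apply: (mulfI (exp2pi_neq0 x)).
by rewrite -exp2piD subrr exp2pi0 divff // exp2pi_neq0.
Qed.

Lemma exp2pi_half : exp2pi (2^-1) = -1.
Proof.
rewrite (_ : 2^-1 = (2^-1 : R) +i* 0); last first.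
  by rewrite -[RHS]/((2^-1)%:C) fmorphV rmorph_nat.
rewrite exp2piE mul0r oppr0 expR0 mulrA mulVf ?pnatr_eq0//.
rewrite [1 * pi]mul1r cospi sinpi.
by rewrite mul1r; apply/eqP; rewrite eq_complex /= oppr0 !eqxx.
Qed.

Lemma exp2pi_int (n : int) : exp2pi n%:~R = 1.
Proof.
have E1 : exp2pi 1 = 1.
  have e2 : 2^-1 + 2^-1 = 1 :> C by field.
  by rewrite -{1}e2 exp2piD exp2pi_half mulrNN mulr1.
have En (k : nat) : exp2pi k%:R = 1.
  by elim: k => [|k IH]; rewrite ?exp2pi0// -natr1 exp2piD IH E1 mulr1.
case: n => n; first exact: En.
by rewrite NegzE mulrNz exp2piN En invr1.
Qed.

(** The modulus e^(- 2 pi b) forces b = 0; the fractional part t of a then satisfies cos(2 pi t) =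
    1, which excludes 0 < t < 1. *)
Lemma exp2pi_eq1 (z : C) : exp2pi z = 1 -> exists n : int, z = n%:~R.
Proof.
case: z => a b; rewrite exp2piE => /eqP; rewrite eq_complex /=.
rewrite !mul0r subr0 addr0; set e := expR _; set c := cos _; set s := sin _.
move=> /andP[/eqP ec /eqP es]; have e0 : 0 < e by apply: expR_gt0.
have s0 : s = 0 by apply/eqP; move/eqP: es; rewrite mulf_eq0 gt_eqF.
have c1 : c = 1.
  have : c ^+ 2 = 1 by rewrite -(cos2Dsin2 (a * (2 * pi))) -/s s0 expr0n addr0.
  move/eqP; rewrite sqrf_eq1 => /orP[/eqP//|/eqP cN1].
  by move: ec; rewrite cN1; nra.
have e1 : e = 1 by rewrite -ec c1 mulr1.
have b0 : b = 0.
  have : - (b * (2 * pi)) = 0 by apply: expR_inj; rewrite expR0.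
  move/eqP; rewrite oppr_eq0 !mulf_eq0 pnatr_eq0 (gt_eqF (pi_gt0 R)) /=.
  by rewrite orbF => /eqP.
exists (Num.floor a); rewrite b0.
suff aE : a = (Num.floor a)%:~R by rewrite {1}aE -(rmorph_int (real_complex R)).
set t := a - (Num.floor a)%:~R.
suff : t = 0 by move/eqP; rewrite subr_eq0 => /eqP.
have [t0 t1] : 0 <= t /\ t < 1.
  by rewrite /t subr_ge0 ltrBlDl floor_le; split=> //; rewrite -intrD1 floorD1_gt.
have ct : cos (t * (2 * pi)) = 1.
  have := exp2piD (t%:C) (Num.floor a)%:~R.
  rewrite exp2pi_int mulr1 -(rmorph_int (real_complex R)) -rmorphD /=.
  rewrite /t subrK !exp2piE !mul0r oppr0 expR0 !mul1r => -[<- _]; exact: c1.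
(* For 0 < t < 1, sin(pi t) > 0, hence cos(2 pi t) = 1 - 2 sin(pi t)^2 < 1. *)
apply/eqP; rewrite eq_le t0 andbT leNgt; apply/negP => tp.
have pi0 := pi_gt0 R.
have /(sin_gt0_pi) sp : 0 < t * pi < pi.
  by rewrite mulr_gt0//= -ltr_pdivlMr// divff ?gt_eqF.
move: ct; rewrite (_ : t * (2 * pi) = (t * pi) *+ 2); last by ring.
by rewrite cos_mulr2n cos2sin2; nra.
Qed.

(** * Limits of complex sequences *)

Lemma normcD (x y : C) : normc (x + y) <= normc x + normc y.
Proof. exact: le_normcD. Qed.

Lemma normc_ge0 (x : C) : 0 <= normc x.
Proof. by case: x => a b; rewrite sqrtr_ge0. Qed.

Lemma normc_real (a : R) : normc a%:C = `|a|.
Proof. by rewrite /= expr0n addr0 sqrtr_sqr. Qed.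

Lemma normc_sum (I : Type) (s : seq I) (P : pred I) (F : I -> C) :
  normc (\sum_(i <- s | P i) F i) <= \sum_(i <- s | P i) normc (F i).
Proof.
elim/big_ind2: _ => [|x a y b xa yb|//]; first by rewrite Normc.normc0.
exact: le_trans (normcD _ _) (lerD xa yb).
Qed.

Lemma normc_le_Re_Im (a b : R) : normc (a +i* b) <= `|a| + `|b|.
Proof.
rewrite -[leRHS]ger0_norm ?addr_ge0// -sqrtr_sqr ler_wsqrtr//.
rewrite -(real_normK (num_real a)) -(real_normK (num_real b)).
by have := normr_ge0 a; have := normr_ge0 b; nra.
Qed.

(** A positive epsilon in [C] is real, so convergence in [C^o] can be tested with the real
    modulus. *)
Lemma cvg_normcP (T : Type) (F : set_system T) (FF : Filter F)
    (f : T -> C^o) (l : C^o) :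
  f @ F --> l <-> forall e : R, 0 < e -> \forall n \near F, normc (f n - l) < e.
Proof.
rewrite cvgrPdistC_lt; split=> [fl e e0|fl e e0].
  by have := fl e%:C; rewrite ltcR => /(_ e0); under eq_near do rewrite ltcR.
have eR : (complex.Re e)%:C = e by apply: RRe_real; exact: gtr0_real.
move: e0; rewrite -eR ltcR => /fl; apply: filterS => n.
by rewrite -ltcR.
Qed.

Lemma cvg_complex (T : Type) (F : set_system T) (FF : Filter F)
    (x y : T -> R) (a b : R) :
  x @ F --> a -> y @ F --> b ->
  (fun n => x n +i* y n : C^o) @ F --> (a +i* b : C^o).
Proof.
move=> xa yb; apply/cvg_normcP => e e0.
have e2 : 0 < e / 2 by rewrite divr_gt0.
move/cvgrPdistC_lt/(_ _ e2) : xa => xa; move/cvgrPdistC_lt/(_ _ e2) : yb.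
apply: filterS2 xa => n xn yn; apply: le_lt_trans (normc_le_Re_Im _ _) _.
by rewrite (splitr e) ltrD.
Qed.

Lemma cvg_slope0 (f : R -> R) (d : R) (h : nat -> R) :
  is_derive (0 : R) 1 f d -> h @ \oo --> 0 -> (forall n, h n != 0) ->
  (fun n => (f (h n) - f 0) / h n) @ \oo --> d.
Proof.
move=> /is_derive1_caratheodory[g [fg gc <-]] h0 hn0.
rewrite (_ : (fun _ => _) = g \o h); last first.
  by apply/funext => n /=; rewrite fg subr0 mulfK.
by apply: continuous_cvg.
Qed.

(** Only real increments occur, so the real and imaginary parts are differentiated at 0 as real
    functions of t. *)
Lemma cvg_exp2pi_slope (w : C) (h : nat -> R) :
  h @ \oo --> 0 -> (forall n, h n != 0) ->
  (fun n => (exp2pi (w * (h n)%:C) - 1) / (h n)%:C : C^o) @ \oo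
    --> ('i * w * (2 * piC R) : C^o).
Proof.
move=> h0 hn0; case: w => a b.
pose f1 t := expR (- (2 * pi * b * t)) * cos (2 * pi * a * t).
pose f2 t := expR (- (2 * pi * b * t)) * sin (2 * pi * a * t).
have d1 : is_derive (0 : R) 1 f1 (- (2 * pi * b)).
  apply: is_derive_eq; rewrite /= !mulr0 oppr0 expR0 cos0 sin0.
  by rewrite /GRing.scale /=; ring.
have d2 : is_derive (0 : R) 1 f2 (2 * pi * a).
  apply: is_derive_eq; rewrite /= !mulr0 oppr0 expR0 cos0 sin0.
  by rewrite /GRing.scale /=; ring.
have E n : (exp2pi ((a +i* b) * (h n)%:C) - 1) / (h n)%:C =
    ((f1 (h n) - f1 0) / h n) +i* ((f2 (h n) - f2 0) / h n).
  have hC : (h n)%:C != 0 by rewrite eq_complex /= negb_and hn0.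
  apply: (canLR (mulfK hC)).
  rewrite /f1 /f2 !mulr0 oppr0 expR0 cos0 sin0 !mulr1 mulr0.
  rewrite -[(a +i* b) * _]/(_ +i* _) exp2piE.
  apply/eqP; rewrite eq_complex /=; apply/andP; split; apply/eqP;
    rewrite !mulr0 !subr0 ?add0r ?mul0r ?addr0 ?subr0 ?mulfVK//.
    by congr (expR _ * cos _ - _); ring.
  by congr (expR _ * sin _); ring.
rewrite (funext E).
have -> : 'i * (a +i* b) * (2 * piC R) = (- (2 * pi * b)) +i* (2 * pi * a).
  by apply/eqP; rewrite eq_complex /=; apply/andP; split; apply/eqP; ring.
have c1 := cvg_slope0 d1 h0 hn0; have c2 := cvg_slope0 d2 h0 hn0.
exact: (cvg_complex _ c1 c2).
Qed.

(** * The duplication formula *)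

Definition nonint (z : C) : Prop := forall n : int, z != n%:~R.

Lemma nonintD (z : C) (k : int) : nonint z -> nonint (z + k%:~R).
Proof. by move=> hz n; rewrite eq_sym -subr_eq -intrB eq_sym. Qed.

Lemma nonint_div (z : C) (k : nat) : (0 < k)%N -> nonint z -> nonint (z / k%:R).
Proof.
move=> k0 hz n; apply: contra (hz (n * k)%R) => /eqP zn.
by rewrite intrM -zn mulfVK// pnatr_eq0 -lt0n.
Qed.

Lemma nonint_exp2pi (z : C) : nonint z -> exp2pi z != 1.
Proof.
by move=> hz; apply/eqP => /exp2pi_eq1[n zn]; have := hz n; rewrite zn eqxx.
Qed.

(* [pcot z] is pi * cot (pi * z) *)
Definition pcot (z : C) : C :=
  piC R * 'i * ((exp2pi z + 1) / (exp2pi z - 1)).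

Lemma pcotD_int (z : C) (k : int) : pcot (z + k%:~R) = pcot z.
Proof. by rewrite /pcot exp2piD exp2pi_int mulr1. Qed.

(** The shift by 1/2 turns e = [exp2pi z] into - e, and the claim becomes an identity of fractions
    with denominators e - 1, - e - 1 and e^2 - 1. *)
Lemma pcot_duplication (z : C) : exp2pi (2 * z) != 1 ->
  pcot z + pcot (z + 2^-1) = 2 * pcot (2 * z).
Proof.
rewrite /pcot exp2piD exp2pi_half mulr2n mulrDl !mul1r exp2piD.
set e := exp2pi z => e1; rewrite -subr_eq0 in e1.
have e0 : (e - 1 != 0) && (e + 1 != 0).
  by rewrite -negb_or -mulf_eq0 (_ : _ * _ = e * e - 1) //; ring.
case/andP: e0 => ea eb; have ec : e * -1 - 1 != 0.
  by rewrite mulrN1 -opprD oppr_eq0.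
by field; rewrite ea ec e1.
Qed.

(** Induction on p: the arguments for k and k + 2^p differ by 1/2, so duplication merges them. *)
Lemma sum_pcot (z : C) (p : nat) : nonint z ->
  \sum_(0 <= k < 2 ^ p) pcot ((z + k%:R) / (2 ^ p)%:R) = (2 ^ p)%:R * pcot z.
Proof.
move=> hz; elim: p => [|p IH].
  by rewrite expn0 big_nat1 addr0 divr1 mul1r.
rewrite expnS mul2n -addnn (big_cat_nat (n := (2 ^ p)%N)) ?leq_addr//=.
have shift (F : nat -> C) :
    \sum_(2 ^ p <= k < 2 ^ p + 2 ^ p) F k = \sum_(0 <= k < 2 ^ p) F (k + 2 ^ p)%N.
  by rewrite -{1}(add0n (2 ^ p)%N) big_addn addnK.
rewrite shift -big_split /=.
have n0 : (2 ^ p)%:R != 0 :> C by rewrite pnatr_eq0 expn_eq0.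
have half (q x : C) : q != 0 -> (x + q) / (q + q) = x / (q + q) + 2^-1.
  by move=> q0; field; rewrite -mulr2n mulrn_eq0.
have twice (q x : C) : q != 0 -> 2 * (x / (q + q)) = x / q.
  by move=> q0; field; rewrite -mulr2n mulrn_eq0 q0.
under eq_big_nat => k kp.
  rewrite !natrD addrA (half _ _ n0) pcot_duplication (twice _ _ n0); last first.
    by apply/nonint_exp2pi/nonint_div; [rewrite expn_gt0|exact: (nonintD k%:Z)].
  over.
by rewrite -mulr_sumr IH natrD; ring.
Qed.

Lemma sum_sym (F : nat -> C) (M : nat) : (0 < M)%N ->
  \sum_(0 <= k < M + M) F k =
  F 0 + \sum_(1 <= k < M) (F k + F (M + M - k)%N) + F M.
Proof.
move=> M0; rewrite (big_cat_nat (n := M)) ?leq_addr//= big_ltn//.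
rewrite [X in _ + X]big_ltn; last by rewrite -addn1 leq_add2l.
rewrite -[X in _ + (_ + X) = _](_ : \sum_(1 <= k < M) F (M + M - k)%N = _).
  by rewrite big_split /=; ring.
rewrite big_nat_rev /= -[in RHS](add1n M) big_addn addnK.
by apply: eq_big_nat => k /andP[k1 kM]; congr F; lia.
Qed.

(** By periodicity the index 2^(p+1) - k stands for - k; the unpaired middle index 2^p shifts the
    argument by 1/2. *)
Lemma pcot_symmetric (z : C) (p : nat) : nonint z ->
  (2 ^ p.+1)%:R * pcot z =
  pcot (z / (2 ^ p.+1)%:R) +
  \sum_(1 <= k < 2 ^ p) (pcot ((z + k%:R) / (2 ^ p.+1)%:R)
                         + pcot ((z - k%:R) / (2 ^ p.+1)%:R))
  + pcot (z / (2 ^ p.+1)%:R + 2^-1).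
Proof.
move=> hz; rewrite -sum_pcot // {1}expnS mul2n -addnn sum_sym ?expn_gt0//.
have n0 : (2 ^ p.+1)%:R != 0 :> C by rewrite pnatr_eq0 expn_eq0.
rewrite addr0; congr (_ + _ + pcot _).
  apply: eq_big_nat => k /andP[k1 kM]; congr (_ + _).
  rewrite addnn -mul2n -expnS natrB; last by rewrite expnS; lia.
  rewrite (_ : _ / _ = (z - k%:R) / (2 ^ p.+1)%:R + 1%:~R) ?pcotD_int//.
  by rewrite mulr1z addrCA mulrDl divff// [LHS]addrC.
rewrite mulrDl; congr (_ + _).
by rewrite expnS natrM invfM mulrCA divff ?mulr1//.
Qed.

(* The poles at [- k] and [k] combine: with u = e^(2 pi i z) and v = e^(2 pi i t)
   the sum is a fraction with denominator (u - 1)^2 + u (2 - v - 1/v). *)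
Lemma pcot_pair (z : C) (t : R) :
  exp2pi (z + t%:C) != 1 -> exp2pi (z - t%:C) != 1 ->
  pcot (z + t%:C) + pcot (z - t%:C) =
  piC R * 'i * (2 * (exp2pi z ^+ 2 - 1) /
    ((exp2pi z - 1) ^+ 2 + exp2pi z * (2 - 2 * cos (2 * pi * t))%:C)).
Proof.
have -> : (2 - 2 * cos (2 * pi * t))%:C = 2 - exp2pi t%:C - (exp2pi t%:C)^-1.
  have expt (x : R) : exp2pi x%:C = cos (2 * pi * x) +i* sin (2 * pi * x).
    rewrite exp2piE mul0r oppr0 expR0 mulrC [x * _]mulrC.
    by apply/eqP; rewrite eq_complex /=; apply/andP; split; apply/eqP; ring.
  have two : 2 = 2 +i* 0 :> C by rewrite -[RHS]/(2%:C) rmorph_nat.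
  rewrite -exp2piN -rmorphN [in RHS]two !expt mulrN cosN sinN.
  by apply/eqP; rewrite eq_complex /=; apply/andP; split; apply/eqP; ring.
rewrite /pcot !exp2piD exp2piN; have v0 := exp2pi_neq0 t%:C.
move: (exp2pi z) (exp2pi t%:C) v0 => u v v0 ha hb; rewrite -mulrDr; congr (_ * _).
have a0 : u * v - 1 != 0 by rewrite subr_eq0.
have b0 : u - v != 0.
  by apply: contra hb; rewrite subr_eq0 => /eqP ->; rewrite divff.
(* Up to the unit v, the denominator is the product of those of the two cotangents. *)
have c0 : (u - 1) ^+ 2 + u * (2 - v - v^-1) = (u * v - 1) * (u - v) / v.
  by field.
by rewrite c0; field; rewrite v0 a0 b0.
Qed.

(** With y = x/2, the mean value theorem gives sin y >= y cos y, hence sin x >= 2 y cos(y)^2 >= y,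
    since 2 cos(y)^2 - 1 = cos x >= 0. *)
Lemma sin_ge_half (x : R) : 0 <= x <= pi / 2 -> x / 2 <= sin x.
Proof.
move=> /andP[x0 xpi]; set y := x / 2.
have y0 : 0 <= y by rewrite divr_ge0.
have pi0 := pi_gt0 R.
have cs : {within `[0, y], continuous (@sin R)}.
  by apply: continuous_subspaceT => u; exact: continuous_sin.
have [c /[!in_itv]/= /andP[c0 cy]] :=
  MVT_segment y0 (fun u _ => is_derive_sin u) cs.
rewrite sin0 !subr0 => sy.
have cyc : cos y <= cos c.
  have [->//|ne] := eqVneq c y; apply/ltW.
  rewrite ltr_cos ?in_itv/= ?lt_neqAle ?ne//; rewrite /y in cy *; lra.
have sy' : y * cos y <= sin y by rewrite sy mulrC ler_wpM2r.
have cy0 : 0 <= cos y by apply: cos_ge0_pihalf; rewrite /y; lra.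
have cx0 : 0 <= cos x by apply: cos_ge0_pihalf; lra.
have xE : x = y *+ 2 by rewrite /y; lra.
move: cx0; rewrite xE sin_mulr2n cos_mulr2n.
move: (cos y) (sin y) cy0 sy' => a b a0 ab a2; nra.
Qed.

(** The right side is 4 sin(pi t)^2 = |1 - e^(2 pi i t)|^2, and sin(pi t) >= pi t / 2 >= t because
    pi >= 2. *)
Lemma chord_ge (t : R) : 0 <= t <= 2^-1 -> 4 * t ^+ 2 <= 2 - 2 * cos (2 * pi * t).
Proof.
move=> /andP[t0 t1]; have pi2 := pi_ge2 R.
have /sin_ge_half s : 0 <= pi * t <= pi / 2 by apply/andP; split; nra.
rewrite (_ : 2 * pi * t = (pi * t) *+ 2); last by ring.
rewrite cos_mulr2n cos2sin2; set u := sin _ in s *.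
have tu : t <= u by apply: le_trans s; nra.
by nra.
Qed.

(** * The partial fraction expansion of the cotangent *)

(** Meant for u = [exp2pi (z * h)] and s = 2 - 2 cos(2 pi k h), as in [pcot_pair]. The numerator is
    at most 6 A h, from |u + 1| <= 3. The denominator is at least (k h)^2: |u| >= 1/2 gives |u s| >=
    2 (k h)^2, while |u - 1|^2 <= (k h)^2. *)
Lemma pair_bound (u : C) (s h A k : R) : 0 < h -> 0 < k -> 0 <= A -> A <= k ->
  normc (u - 1) <= A * h -> A * h <= 2^-1 -> 4 * (k * h) ^+ 2 <= s ->
  normc (2 * (u ^+ 2 - 1) / ((u - 1) ^+ 2 + u * s%:C)) * h <= 6 * A / k ^+ 2.
Proof.
move=> h0 k0 A0 Ak u1 Ah sk; set w := normc (u - 1) in u1 *.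
have w0 : 0 <= w by exact: normc_ge0.
have uD : normc (u + 1) <= 3.
  rewrite (_ : u + 1 = (u - 1) + 2%:C); last by rewrite rmorph_nat; ring.
  by apply: le_trans (normcD _ _) _; rewrite normc_real ger0_norm// -/w; lra.
have uL : 2^-1 <= normc u.
  have := normcD u (1 - u); rewrite addrC subrK Normc.normc1.
  rewrite -(normcN (1 - u)) opprB -/w; lra.
set d := (u - 1) ^+ 2 + _.
have dL : (k * h) ^+ 2 <= normc d.
  have : normc (u * s%:C) <= normc d + normc (- (u - 1) ^+ 2).
    by apply: le_trans _ (normcD _ _); rewrite /d [X in _ <= normc X]addrC addKr.
  rewrite normcN expr2 !Normc.normcM -/w normc_real ger0_norm; last first.
    by apply: le_trans sk; rewrite mulr_ge0 ?sqr_ge0.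
  have w2 : w * w <= (k * h) ^+ 2.
    rewrite expr2; apply: ler_pM => //;
      by apply: (le_trans u1); rewrite ler_wpM2r// ltW.
  have us : 2^-1 * (4 * (k * h) ^+ 2) <= normc u * s.
    by move: sk uL (sqr_ge0 (k * h)); move: (normc u) (_ ^+ 2) => U X; nra.
  by lra.
have kh0 : 0 < (k * h) ^+ 2 by rewrite exprn_gt0// mulr_gt0.
have two : 2 = 2%:C :> C by rewrite rmorph_nat.
rewrite !Normc.normcM Normc.normcV [in normc 2]two normc_real.
rewrite (_ : u ^+ 2 - 1 = (u - 1) * (u + 1)); last by ring.
rewrite Normc.normcM -/w ger0_norm// mulrAC ler_pdivrMr ?(lt_le_trans kh0)//.
have kk : k ^+ 2 != 0 by rewrite sqrf_eq0 gt_eqF.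
apply: le_trans (_ : 6 * A / k ^+ 2 * (k * h) ^+ 2 <= _); last first.
  by rewrite ler_wpM2l// divr_ge0 ?sqr_ge0// mulr_ge0.
rewrite exprMn [leRHS]mulrA mulfVK//; move: (normc (u + 1)) (normc_ge0 (u + 1)) uD.
by move=> v v0 v3; have := ler_pM w0 v0 u1 v3; nra.
Qed.

(** Telescoping, from 1/k^2 <= 1/(k - 1) - 1/k. *)
Lemma sum_inv_sqr (N M : nat) : (0 < N)%N ->
  \sum_(N.+1 <= k < M) (k%:R ^+ 2)^-1 <= N%:R^-1 :> R.
Proof.
move=> N0.
have [MN|NM] := leqP M N.+1; first by rewrite big_geq// invr_ge0.
apply: le_trans (_ : N%:R^-1 - M.-1%:R^-1 <= _); last first.
  by rewrite gerBl invr_ge0.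
have -> : N%:R^-1 - M.-1%:R^-1 =
    \sum_(N.+1 <= k < M) (k.-1%:R^-1 - k%:R^-1) :> R.
  rewrite -(prednK (ltn_trans (ltn0Sn _) NM)) big_add1 /=.
  rewrite -[LHS]opprB -(telescope_sumr (fun k => k%:R^-1)); last by lia.
  by rewrite -sumrN; apply: eq_bigr => k _; rewrite opprB.
apply: ler_sum_nat => k /andP[Nk _]; have k1 : (1 < k)%N by lia.
rewrite -[k]prednK ?(ltn_trans _ k1)//= -natr1.
have : 0 < k.-1%:R :> R by rewrite ltr0n; lia.
move: (k.-1%:R) => x x0.
have -> : x^-1 - (x + 1)^-1 = (x * (x + 1))^-1 by field; rewrite !gt_eqF//; lra.
by rewrite lef_pV2 ?posrE; nra.
Qed.

(** Symmetric sum of 1/(z + n) over |n| <= N, grouped in pairs n, - n to match [pcot_symmetric]. *)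
Definition psum (z : C) (N : nat) : C :=
  z^-1 + \sum_(1 <= k < N.+1) ((z + k%:R)^-1 + (z - k%:R)^-1).

(** Mesh of the average in [pcot_symmetric]; for 0 < k < 2^p it keeps k h below 1/2, within the
    range of [chord_ge]. *)
Let h (p : nat) : R := (2 ^ p.+1)%:R^-1.

Let h_gt0 p : 0 < h p.
Proof. by rewrite invr_gt0 ltr0n expn_gt0. Qed.

Let hC p : (h p)%:C = (2 ^ p.+1)%:R^-1.
Proof. by rewrite fmorphV rmorph_nat. Qed.

Let cvg_h : h @ \oo --> 0.
Proof.
have hE : h = fun p => 2^-1 ^+ p.+1 by apply/funext => p; rewrite /h natrX exprVn.
rewrite hE cvg_shiftS; apply: cvg_expr.
by rewrite ger0_norm// invf_lt1// ltr1n.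
Qed.

Let h_neq0 p : h p != 0. Proof. by rewrite gt_eqF. Qed.

Let hC_neq0 p : (h p)%:C != 0.
Proof. by rewrite hC invr_eq0 pnatr_eq0 expn_eq0. Qed.

Let cvg_hC : (fun p => (h p)%:C : C^o) @ \oo --> (0 : C^o).
Proof.
apply/cvg_normcP => e e0; have /cvgr0Pnorm_lt/(_ e e0) := cvg_h.
by apply: filterS => p; rewrite subr0 normc_real.
Qed.

Let cvg_exp (w : C) : (fun p => exp2pi (w * (h p)%:C) : C^o) @ \oo --> (1 : C^o).
Proof.
have -> : (fun p => exp2pi (w * (h p)%:C) : C^o) =
    (fun p => (exp2pi (w * (h p)%:C) - 1) / (h p)%:C * (h p)%:C + 1 : C^o).
  by apply/funext => p; rewrite mulfVK ?subrK.
rewrite -[X in _ --> X]add0r; apply: cvgD; last exact: cvg_cst.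
rewrite -(mulr0 ('i * w * (2 * piC R))).
by apply: cvgM cvg_hC; exact: cvg_exp2pi_slope.
Qed.

Let piC_neq0 : piC R != 0.
Proof. by rewrite /piC eq_complex /= negb_and gt_eqF// pi_gt0. Qed.

(** The slope (e^(2 pi i w h) - 1) / h tends to 2 pi i w, while e^(2 pi i w h) + 1 tends to 2. *)
Lemma cvg_pcot_scaled (w : C) : w != 0 ->
  (fun p => (h p)%:C * pcot (w * (h p)%:C) : C^o) @ \oo --> (w^-1 : C^o).
Proof.
move=> w0; have sl := cvg_exp2pi_slope (w := w) cvg_h h_neq0.
have i0 : 'i != 0 :> C by rewrite eq_complex /= oner_eq0 andbF.
have L0 : 'i * w * (2 * piC R) != 0 by rewrite !mulf_neq0 ?pnatr_eq0.
have -> : (fun p => (h p)%:C * pcot (w * (h p)%:C) : C^o) =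
    (fun p => piC R * 'i * ((exp2pi (w * (h p)%:C) + 1)
      / ((exp2pi (w * (h p)%:C) - 1) / (h p)%:C)) : C^o).
  by apply/funext => p; rewrite /pcot invfM invrK; ring.
have -> : w^-1 = piC R * 'i * ((1 + 1) / ('i * w * (2 * piC R))).
  by move: piC_neq0; move: (piC R) => x x0; field; rewrite x0 w0.
apply: cvgM; first exact: cvg_cst.
apply: cvgM; last exact: cvgV.
by apply: cvgD; [exact: cvg_exp|exact: cvg_cst].
Qed.

(** This disposes of the unpaired middle term: the exponential tends to -1, so the denominator tends
    to -2 and the cotangent stays bounded. *)
Lemma cvg_pcot_half (w : C) :
  (fun p => (h p)%:C * pcot (w * (h p)%:C + 2^-1) : C^o) @ \oo --> (0 : C^o).
Proof.
rewrite -[X in _ --> X](mul0r (piC R * 'i * ((1 * -1 + 1) / (1 * -1 - 1)))).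
apply: cvgM cvg_hC _; apply: cvgM; first exact: cvg_cst.
have -> : (fun p => (exp2pi (w * (h p)%:C + 2^-1) + 1)
                    / (exp2pi (w * (h p)%:C + 2^-1) - 1) : C^o) =
  (fun p => (exp2pi (w * (h p)%:C) * -1 + 1) / (exp2pi (w * (h p)%:C) * -1 - 1)).
  by apply/funext => p; rewrite exp2piD exp2pi_half.
have c : (fun p => exp2pi (w * (h p)%:C) * -1 : C^o) @ \oo --> (1 * -1 : C^o).
  by apply: cvgM; [exact: cvg_exp|exact: cvg_cst].
apply: cvgM; first by apply: cvgD c _; exact: cvg_cst.
apply: cvgV; last by apply: (cvgD c); exact: cvg_cst.
by rewrite mul1r -opprD oppr_eq0 -mulr2n pnatr_eq0.
Qed.

Lemma cvg_sumr (I : Type) (s : seq I) (f : I -> nat -> C^o) (l : I -> C^o) :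
  (forall i, f i @ \oo --> l i) ->
  (fun n => \sum_(i <- s) f i n : C^o) @ \oo --> (\sum_(i <- s) l i : C^o).
Proof.
move=> fl; elim: s => [|i s IH].
  rewrite big_nil; under eq_fun do rewrite big_nil.
  exact: cvg_cst.
rewrite big_cons; under eq_fun do rewrite big_cons.
exact: cvgD (fl i) IH.
Qed.

(** * Head and tail of the cotangent average *)

Let pair (z : C) p k :=
  pcot ((z + k%:R) / (2 ^ p.+1)%:R) + pcot ((z - k%:R) / (2 ^ p.+1)%:R).

Lemma cvg_head (z : C) (N : nat) : nonint z ->
  (fun p => (h p)%:C * (pcot (z / (2 ^ p.+1)%:R) + \sum_(1 <= k < N.+1) pair z p k)
    : C^o) @ \oo --> (psum z N : C^o).
Proof.
move=> hz; have nz (w : C) (k : int) : w = z + k%:~R -> w != 0.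
  by move=> ->; exact: (nonintD k hz 0).
under eq_fun do rewrite mulrDr mulr_sumr.
apply: cvgD.
  under eq_fun do rewrite -hC.
  by apply/cvg_pcot_scaled/(nz _ 0); rewrite addr0.
apply: cvg_sumr => k; rewrite /pair.
under eq_fun do rewrite mulrDr -!hC.
apply: cvgD; apply: cvg_pcot_scaled; first exact: (nz _ k%:Z).
by apply: (nz _ (- k%:Z)); rewrite mulrNz.
Qed.

(** The threshold on p is independent of N: it only has to bring the slope of [exp2pi] within 1 of L
    = 2 pi i z, so that |u - 1| <= A h, and to make A h <= 1/2. Then [pair_bound] applies to every k
    > N >= A. *)
Lemma tail_bound (z : C) : nonint z -> exists A B : R, 0 <= B /\
  \forall p \near \oo, forall N : nat, (0 < N)%N -> A <= N%:R ->
    normc ((h p)%:C * \sum_(N.+1 <= k < 2 ^ p) pair z p k) <= B / N%:R.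
Proof.
move=> hz; set L := 'i * z * (2 * piC R); set A := normc L + 1.
have A0 : 0 < A by rewrite /A ltr_wpDl// normc_ge0.
(* The factor 6 A comes from [pair_bound], pi from the modulus of the prefactor pi i in
   [pcot_pair]. *)
exists A, (pi * (6 * A)); split; first by rewrite !mulr_ge0 ?pi_ge0 ?ltW.
have := cvg_exp2pi_slope (w := z) cvg_h h_neq0.
move=> /cvg_normcP/(_ 1 ltr01) near1.
have A2 : 0 < 2^-1 / A by rewrite divr_gt0.
have /cvgr0Pnorm_lt/(_ _ A2) near2 := cvg_h.
move: near1 near2; apply: filterS2 => p; rewrite -/L ger0_norm ?(ltW (h_gt0 p))//.
set u := exp2pi _ => uL hA N N0 AN.
have Ah : A * h p <= 2^-1 by rewrite mulrC -ler_pdivlMr// ltW.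
have uA : normc (u - 1) <= A * h p.
  have : normc ((u - 1) / (h p)%:C) <= A.
    rewrite -[X in normc X](subrK L); apply: le_trans (normcD _ _) _.
    by rewrite addrC lerD2l ltW.
  rewrite Normc.normcM Normc.normcV normc_real ger0_norm ?(ltW (h_gt0 p))//.
  by rewrite ler_pdivrMr.
apply: le_trans (_ : \sum_(N.+1 <= k < 2 ^ p) pi * (6 * A) * (k%:R ^+ 2)^-1 <= _);
    last first.
  by rewrite -mulr_sumr ler_wpM2l ?sum_inv_sqr// !mulr_ge0 ?pi_ge0 ?ltW.
rewrite mulr_sumr; apply: le_trans (normc_sum _ _ _) _.
apply: ler_sum_nat => k /andP[Nk kp].
have k0 : 0 < k%:R :> R by rewrite ltr0n; lia.
have zk : (z + k%:R) / (2 ^ p.+1)%:R = z * (h p)%:C + (k%:R * h p)%:C.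
  by rewrite -hC mulrDl rmorphM /= rmorph_nat.
have zk' : (z - k%:R) / (2 ^ p.+1)%:R = z * (h p)%:C - (k%:R * h p)%:C.
  by rewrite -hC mulrBl rmorphM /= rmorph_nat.
rewrite /pair zk zk' pcot_pair -?zk -?zk'; last 2 first.
- by apply/nonint_exp2pi/nonint_div; [rewrite expn_gt0|exact: (nonintD k%:Z)].
- apply/nonint_exp2pi/nonint_div; first by rewrite expn_gt0.
  by have := nonintD (- k%:Z) hz; rewrite mulrNz.
have chord : 4 * (k%:R * h p) ^+ 2 <= 2 - 2 * cos (2 * pi * (k%:R * h p)).
  apply: chord_ge; rewrite mulr_ge0 ?ler0n ?(ltW (h_gt0 p))//=.
  rewrite /h ler_pdivrMr ?ltr0n ?expn_gt0// expnS natrM mulKf ?pnatr_eq0//.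
  by rewrite ler_nat ltnW.
have Ak : A <= k%:R by apply: le_trans AN _; rewrite ler_nat; lia.
have := pair_bound (h_gt0 p) k0 (ltW A0) Ak uA Ah chord.
rewrite -/u; set X := 2 * (u ^+ 2 - 1) / _ => XB.
have -> : normc ((h p)%:C * (piC R * 'i * X)) = pi * (normc X * h p).
  rewrite !Normc.normcM /piC !normc_real !ger0_norm ?pi_ge0 ?(ltW (h_gt0 p))//.
  have -> : normc 'i = 1 by rewrite /= expr0n/= expr1n add0r sqrtr1.
  by ring.
by rewrite -[leRHS]mulrA ler_wpM2l// pi_ge0.
Qed.

(** Once N < 2^p, [pcot z] splits into a head, tending to [psum z N] as p grows, and a tail whose
    bound does not depend on p. *)
Lemma psum_bound (z : C) : nonint z -> exists A B : R, 0 <= B /\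
  forall N : nat, (0 < N)%N -> A <= N%:R ->
    normc (psum z N - pcot z) <= B / N%:R.
Proof.
move=> hz; have [A [B [B0 tail]]] := tail_bound hz.
exists A, B; split=> // N N0 AN; apply/ler_addgt0Pr => e e0.
have cX : (fun p =>
    (h p)%:C * (pcot (z / (2 ^ p.+1)%:R) + \sum_(1 <= k < N.+1) pair z p k)
    + (h p)%:C * pcot (z * (h p)%:C + 2^-1) : C^o) @ \oo --> (psum z N : C^o).
  rewrite -[X in _ --> X]addr0.
  by apply: cvgD; [exact: cvg_head|exact: cvg_pcot_half].
move/cvg_normcP/(_ e e0) : cX => near1.
have near2 : \forall p \near \oo, (N < p)%N by exists N.+1.
(* One p per epsilon suffices; N < p gives N < 2^p, so the sum can be cut at N + 1. *)
have [p [/= Np [tailp headp]]] :=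
  filter_ex (filterI near2 (filterI tail near1)).
have N2p : (N < 2 ^ p)%N by apply: ltn_trans Np _; exact: ltn_expl.
have n0 : (2 ^ p.+1)%:R != 0 :> C by rewrite pnatr_eq0 expn_eq0.
have pE : pcot z =
    (h p)%:C * (pcot (z / (2 ^ p.+1)%:R) + \sum_(1 <= k < N.+1) pair z p k)
    + (h p)%:C * pcot (z * (h p)%:C + 2^-1)
    + (h p)%:C * \sum_(N.+1 <= k < 2 ^ p) pair z p k.
  rewrite -[LHS](mulKf n0) pcot_symmetric// !hC -!mulrDr; congr (_ * _).
  by rewrite (big_cat_nat (n := N.+1))//=; ring.
move: headp (tailp N N0 AN); rewrite pE.
set X := _ + _ * pcot _; set Y := _ * \sum_(_ <= _ < 2 ^ p) _ => XS YB.
rewrite (_ : _ - _ = - (X - psum z N) - Y); last by ring.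
apply: le_trans (normcD _ _) _; rewrite !normcN addrC lerD// ltW//.
Qed.

Lemma cvg_psum (z : C) : nonint z -> (psum z : nat -> C^o) @ \oo --> (pcot z : C^o).
Proof.
move=> hz; have [A [B [B0 bound]]] := psum_bound hz.
apply/cvg_normcP => e e0.
have near1 : \forall N \near \oo, (0 < N)%N by exists 1%N.
have near2 := nbhs_infty_ger A.
have near3 := nbhs_infty_gtr (B / e).
move: near1 near2 near3; apply: filterS3 => N N0 AN BN.
apply: le_lt_trans (bound N N0 AN) _.
by rewrite ltr_pdivrMr ?ltr0n// mulrC -ltr_pdivrMr.
Qed.

(** * Two-sided series *)

Lemma zpartialS (u : int -> C) (N : nat) :
  zpartial u N.+1 = zpartial u N + (u N.+1%:Z + u (- N.+1%:Z)).
Proof.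
rewrite /zpartial doubleS big_ord_recl big_ord_recr /= sub0r.
rewrite [RHS]addrA [RHS]addrC; congr (_ + (_ + u _)); last first.
  by rewrite /bump; lia.
by apply: eq_bigr => j _; congr u; rewrite /= /bump; lia.
Qed.

Lemma zpartial0 (u : int -> C) : zpartial u 0 = u 0.
Proof. by rewrite /zpartial big_ord_recl big_ord0 addr0. Qed.

(** Since 1/(n - r) = - 1/(r - n), the symmetric partial sum is the opposite of [psum r N]. *)
Lemma cvg_zpartial_inv (r : C) : nonint r ->
  zpartial (fun n => (n%:~R - r)^-1) @ \oo --> (- pcot r : C^o).
Proof.
move=> hr; have -> : zpartial (fun n => (n%:~R - r)^-1) = (fun N => - psum r N : C^o).
  apply/funext; elim=> [|N IH].
    by rewrite zpartial0 /psum big_geq// addr0 sub0r invrN.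
  rewrite zpartialS IH /psum [in RHS]big_nat_recr//=.
  rewrite mulrNz -opprD invrN -(opprB r) invrN [_ + r]addrC.
  by move: (\sum_(_ <= _ < _) _) (_^-1) (_^-1) (_^-1) => *; ring.
by apply: cvgN; exact: cvg_psum.
Qed.

(** The sign is 2 - 1 at even n and 0 - 1 at odd n; the even n with |n| <= N are the 2 k with |k| <=
    [N./2]. *)
Lemma zpartial_alt (u : int -> C) (N : nat) :
  zpartial (fun n => (-1) ^ n * u n) N =
  2 * zpartial (fun n => u (2 * n)) N./2 - zpartial u N.
Proof.
elim: N => [|N IH]; first by rewrite !zpartial0 mulr0 expr0z mul1r; ring.
rewrite !zpartialS IH -invr_expz -exprnP -signr_odd invr_sign.
rewrite -uphalfE uphalf_half oddS.
(* The new indices N + 1 and - (N + 1) are even exactly when N is odd, and only then does the half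
   increase. *)
case: (boolP (odd N)) => oN /=; rewrite ?expr1 ?expr0 ?add0n ?add1n.
  rewrite zpartialS (_ : 2 * _ = N.+1%:Z); last by lia.
  rewrite (_ : 2 * _ = - N.+1%:Z); last by lia.
  by ring.
by ring.
Qed.

Lemma cvg_half : half @ \oo --> \oo.
Proof.
move=> A [N0 _ HN]; exists N0.*2 => // n /= Nn; apply: HN => /=.
by rewrite -(doubleK N0) half_leq.
Qed.

(** Since 2 / (2 n - r) = 1 / (n - r/2), twice the even part is the plain series at r/2. *)
Lemma cvg_zpartial_alt_inv (r : C) : nonint r ->
  zpartial (fun n => (-1) ^ n * (n%:~R - r)^-1) @ \oo
    --> (pcot r - pcot (r / 2) : C^o).
Proof.
move=> hr.
have c : (fun N => 2 * zpartial (fun n => ((2 * n)%:~R - r)^-1) N./2 : C^o) @ \oo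
    --> (- pcot (r / 2) : C^o).
  have -> : (fun N => 2 * zpartial (fun n => ((2 * n)%:~R - r)^-1) N./2 : C^o) =
      zpartial (fun n => (n%:~R - r / 2)^-1) \o half.
    apply/funext => N /=; rewrite /zpartial mulr_sumr; apply: eq_bigr => j _.
    rewrite intrM (_ : _ - r = 2 * ((j%:Z - N./2%:Z)%:~R - r / 2)).
      by rewrite invfM mulVKf.
    by rewrite mulrBr mulrCA divff// mulr1.
  apply: cvg_comp cvg_half _; apply: cvg_zpartial_inv.
  exact: (nonint_div (k := 2)).
rewrite (funext (zpartial_alt _)) -[pcot r]opprK addrC.
exact: cvgB c (cvg_zpartial_inv hr).
Qed.

(* e^(- i r pi) is the inverse of e^(2 pi i (r / 2)). *)
Lemma pcot_expC (r : C) (e := expC (- ('i * r * piC R))) : nonint r ->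
  [/\ e ^+ 2 - 1 != 0,
      - pcot r = piC R * 'i * (1 + e ^+ 2) / (e ^+ 2 - 1)
    & pcot r - pcot (r / 2) = 2 * (piC R * 'i * e) / (e ^+ 2 - 1)].
Proof.
move=> hr; have e0 : e != 0 := expC_neq0 _.
have E2 : exp2pi (r / 2) = e^-1.
  apply: (mulIf e0); rewrite mulVf// /exp2pi /e -expCD.
  by rewrite (_ : _ + _ = 0) ?expC0//; move: (piC R) => x; field.
have E1 : exp2pi r = e ^- 2.
  by rewrite -exprVn -E2 expr2 -exp2piD; congr exp2pi; field.
have := nonint_exp2pi hr; rewrite E1 invr_eq1 -subr_eq0 => e1.
have em : e - 1 != 0.
  by apply: contra e1; rewrite [e - 1 == 0]subr_eq0 => /eqP ->; rewrite expr1n subrr.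
rewrite /pcot E1 E2; move: (e) e0 e1 em => x x0 x1 xm.
have y1 : 1 - x ^+ 2 != 0 by rewrite -opprB oppr_eq0.
have y2 : 1 - x != 0 by rewrite -opprB oppr_eq0.
by split=> //; move: (piC R) => y; field; rewrite !mulN1r x0 x1 y1 ?y2.
Qed.

(** * Partial fractions and the associated matrix *)

Lemma size_prod_but_one (F : fieldType) (m : nat) (r : 'I_m -> F) (j : 'I_m) :
  size (\prod_(s < m | s != j) ('X - (r s)%:P)) = m.
Proof.
rewrite -big_filter size_prod_XsubC size_filter -sum1_count.
rewrite (eq_bigl (predC1 j)) // sum1_card cardC1 card_ord prednK//.
exact: leq_ltn_trans (ltn_ord j).
Qed.

(* Lagrange interpolation of ['X^k] at the roots *)
Lemma partial_fractions (F : fieldType) (m k : nat) (r : 'I_m -> F) (x : F) :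
  injective r -> (k < m)%N -> (forall j, x != r j) ->
  x ^+ k / \prod_(j < m) (x - r j) =
  \sum_(j < m) r j ^+ k * (\prod_(s < m | s != j) (r j - r s)^-1) * (x - r j)^-1.
Proof.
move=> rI km xr.
pose q := \sum_(j < m) (r j ^+ k * \prod_(s < m | s != j) (r j - r s)^-1)
  *: \prod_(s < m | s != j) ('X - (r s)%:P).
have hp y j : (\prod_(s < m | s != j) ('X - (r s)%:P)).[y] =
    \prod_(s < m | s != j) (y - r s).
  by rewrite horner_prod; apply: eq_bigr => s _; rewrite hornerXsubC.
(* The difference has size at most m and vanishes at the m distinct points r i. *)
have q0 : 'X^k - q = 0.
  apply: (@roots_geq_poly_eq0 _ _ [seq r j | j <- enum 'I_m]).
  - apply/allP => _ /mapP[i _ ->]; apply/rootP.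
    rewrite hornerD hornerN hornerXn horner_sum (bigD1 i)//=.
    rewrite [X in _ - (_ + X)]big1 ?addr0 => [|j ji].
      rewrite hornerZ hp -mulrA -big_split /= big1 ?mulr1 ?subrr// => s si.
      by rewrite mulVf// subr_eq0; apply: contra si => /eqP/rI ->.
    by rewrite hornerZ hp [X in _ * X](bigD1 i) 1?eq_sym//= subrr mul0r mulr0.
  - by rewrite map_inj_uniq ?enum_uniq.
  - rewrite size_map size_enum_ord (leq_trans (size_polyD _ _))// size_polyN.
    rewrite geq_max size_polyXn km (leq_trans (size_sum _ _ _))//.
    apply/bigmax_leqP => j _; rewrite (leq_trans (size_scale_leq _ _))//.
    by rewrite size_prod_but_one.
have xk : x ^+ k = q.[x].
  by apply/eqP; rewrite -subr_eq0 -[x ^+ k]hornerXn -hornerN -hornerD q0 horner0.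
rewrite xk /q horner_sum mulr_suml; apply: eq_bigr => j _.
rewrite hornerZ hp -[LHS]mulrA; congr (_ * _).
rewrite [X in _ / X](bigD1 j)//= invfM mulrCA mulfV ?mulr1//.
by apply/prodf_neq0 => s _; rewrite subr_eq0 xr.
Qed.

(* At a repeated root every row polynomial vanishes. *)
Lemma assoc_matrix_unit_inj (m : nat) (r : 'I_m -> C) :
  assoc_matrix r \in unitmx -> injective r.
Proof.
move=> U a b rab; apply/eqP/negP => /negP ab.
pose v : 'cV[C]_m := \col_k r a ^+ k.
(* Entry l of the product is the l-th row polynomial at the repeated root. In its summand j the
   factor of index b (if j = a) or a (otherwise) vanishes. *)
have Cv : assoc_matrix r *m v = 0.
  apply/matrixP => l i; rewrite !mxE.
  rewrite (eq_bigr (fun k : 'I_m => (assoc_row r l)`_k * r a ^+ k)); last first.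
    by move=> k _; rewrite !mxE.
  rewrite -horner_coef_wide; last first.
    rewrite (leq_trans (size_scale_leq _ _))// (leq_trans (size_sum _ _ _))//.
    apply/bigmax_leqP => j _; rewrite (leq_trans (size_scale_leq _ _))//.
    by rewrite size_prod_but_one.
  rewrite hornerZ horner_sum big1 ?mulr0// => j _.
  rewrite hornerZ horner_prod; have [ja|ja] := eqVneq a j.
    rewrite (bigD1 b) /=; last by rewrite -ja eq_sym.
    by rewrite hornerXsubC rab subrr mul0r mulr0.
  by rewrite (bigD1 a)//= hornerXsubC subrr mul0r mulr0.
have v0 : v = 0 by rewrite -(mulKmx U v) Cv mulmx0.
have m0 : (0 < m)%N by exact: leq_ltn_trans (ltn_ord a).
(* The entry of index 0 is the power of exponent 0, hence 1 even if the root is 0. *)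
have := congr1 (fun w : 'cV[C]_m => w (Ordinal m0) 0) v0.
by rewrite !mxE expr0 => /eqP; rewrite oner_eq0.
Qed.

(** * Field expressions for the values *)

Section Expressions.
Variable m : nat.

Definition fsum (I : Type) (s : seq I) (f : I -> fexpr m) : fexpr m :=
  foldr (fun i => FAdd (f i)) (FRat m 0) s.

Definition fprod (I : Type) (s : seq I) (f : I -> fexpr m) : fexpr m :=
  foldr (fun i => FMul (f i)) (FRat m 1) s.

Definition fpow (e : fexpr m) (k : nat) : fexpr m := iter k (FMul e) (FRat m 1).

Definition fsub (e1 e2 : fexpr m) : fexpr m := FAdd e1 (FOpp e2).

Variable r : 'I_m -> C.

Lemma feval_sum (I : Type) (s : seq I) (f : I -> fexpr m) :
  feval r (fsum s f) = \sum_(i <- s) feval r (f i).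
Proof. by elim: s => [|i s IH]; rewrite ?big_nil ?big_cons /= ?rmorph0 ?IH. Qed.

Lemma fdefined_sum (I : Type) (s : seq I) (f : I -> fexpr m) :
  (forall i, fdefined r (f i)) -> fdefined r (fsum s f).
Proof. by move=> fd; elim: s => [|i s IH]. Qed.

Lemma feval_prod (I : Type) (s : seq I) (f : I -> fexpr m) :
  feval r (fprod s f) = \prod_(i <- s) feval r (f i).
Proof. by elim: s => [|i s IH]; rewrite ?big_nil ?big_cons /= ?rmorph1 ?IH. Qed.

(** Restricting to members of s lets the residue product avoid inverting r j - r j. *)
Lemma fdefined_prod (I : eqType) (s : seq I) (f : I -> fexpr m) :
  (forall i, i \in s -> fdefined r (f i)) -> fdefined r (fprod s f).
Proof.
elim: s => [//|i s IH] fd; split; first by apply: fd; rewrite mem_head.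
by apply: IH => j js; apply: fd; rewrite in_cons js orbT.
Qed.

Lemma feval_pow (e : fexpr m) (k : nat) : feval r (fpow e k) = feval r e ^+ k.
Proof. by elim: k => [|k IH]; rewrite /= ?rmorph1// IH exprS. Qed.

Lemma fdefined_pow (e : fexpr m) (k : nat) : fdefined r e -> fdefined r (fpow e k).
Proof. by move=> ed; elim: k => [|k IH]. Qed.

(** [divring_closed] gives 1, differences and quotients; the other operations and the rational
    constants are built from these before the induction on e. *)
Lemma feval_closed (K : set C) : divring_closed (mem K) -> K 'i -> K (piC R) ->
  (forall j, K (r j)) -> (forall j, K (expC (- ('i * r j * piC R)))) ->
  forall e, K (feval r e).
Proof.
case=> [/set_mem K1 KB0 KD0] Ki Kpi Kr Ke.
have KB x y : K x -> K y -> K (x - y).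
  by move=> Kx Ky; apply/set_mem/KB0; apply/mem_set.
have KD x y : K x -> K y -> K (x / y).
  by move=> Kx Ky; apply/set_mem/KD0; apply/mem_set.
have K0 : K 0 by rewrite -(subrr 1); exact: KB.
have KN x : K x -> K (- x) by move=> Kx; rewrite -sub0r; exact: KB.
have KA x y : K x -> K y -> K (x + y).
  by move=> Kx Ky; rewrite -[y]opprK; apply/KB/KN.
have KV x : K x -> K x^-1 by move=> Kx; rewrite -div1r; exact: KD.
have KM x y : K x -> K y -> K (x * y).
  by move=> Kx Ky; rewrite -[y]invrK; apply/KD/KV.
have Knat (n : nat) : K n%:R by elim: n => [//|n IH]; rewrite -natr1; exact: KA.
have Kint (n : int) : K n%:~R 
  by case: n => n; [exact: Knat|rewrite NegzE mulrNz; apply/KN/(Knat n.+1)].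
elim=> [q|||j|j|e1 K1' e2 K2|e1 K1'|e1 K1' e2 K2|e1 K1'] //=.
- by rewrite /ratr; apply: KD.
- exact: KA.
- exact: KN.
- exact: KM.
- exact: KV.
Qed.

End Expressions.

Section Values.
Variables (m : nat) (j : 'I_m).

(** The residue r_j^k / P'(r_j) of x^k / P(x) at a simple root r_j. *)
Definition residue_expr (k : nat) : fexpr m :=
  FMul (fpow (FRoot j) k)
    (fprod [seq s <- index_enum 'I_m | s != j]
      (fun s => FInv (fsub (FRoot j) (FRoot s)))).

Definition exp2_subr1_expr : fexpr m := fsub (fpow (FExp j) 2) (FRat m 1).

(** This is - pi cot(pi r_j) in terms of e^(- i pi r_j). *)
Definition cot_expr : fexpr m :=
  FMul (FMul (FMul (FPi m) (FI m)) (FAdd (FRat m 1) (fpow (FExp j) 2)))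
    (FInv exp2_subr1_expr).

(** This is - pi / sin(pi r_j) in terms of e^(- i pi r_j). *)
Definition csc_expr : fexpr m :=
  FMul (FMul (FRat m 2) (FMul (FMul (FPi m) (FI m)) (FExp j)))
    (FInv exp2_subr1_expr).

Variable r : 'I_m -> C.

Lemma residue_exprP (k : nat) : injective r ->
  fdefined r (residue_expr k) /\
  feval r (residue_expr k) = r j ^+ k * \prod_(s < m | s != j) (r j - r s)^-1.
Proof.
move=> rI; split.
  split; first exact: fdefined_pow.
  apply: fdefined_prod => s; rewrite mem_filter => /andP[sj _]; split=> //=.
  by rewrite subr_eq0; apply: contra sj => /eqP/rI ->.
by rewrite /= feval_pow feval_prod big_filter.
Qed.

Lemma cot_exprP : nonint (r j) ->
  fdefined r cot_expr /\ feval r cot_expr = - pcot (r j).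
Proof.
move=> hr; have [e1 -> _] := pcot_expC hr.
by split; rewrite /= ?rmorph1 !mulr1 -!expr2.
Qed.

Lemma csc_exprP : nonint (r j) ->
  fdefined r csc_expr /\ feval r csc_expr = pcot (r j) - pcot (r j / 2).
Proof.
move=> hr; have [e1 _ ->] := pcot_expC hr.
by split; rewrite /= ?rmorph1 ?rmorph_nat !mulr1 -!expr2.
Qed.

End Values.

(** * Summation over the roots *)

Lemma zsumE (u : int -> C) (l : C) :
  zpartial u @ \oo --> (l : C^o) -> zsum u = l.
Proof. by move=> ul; apply: cvg_lim ul; exact: norm_hausdorff. Qed.

Lemma cvg_zpartial_sum (m : nat) (c l : 'I_m -> C) (v : 'I_m -> int -> C)
    (u : int -> C) :
  (forall n, u n = \sum_(j < m) c j * v j n) ->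
  (forall j, zpartial (v j) @ \oo --> (l j : C^o)) ->
  zpartial u @ \oo --> (\sum_(j < m) c j * l j : C^o).
Proof.
move=> uE vl.
have -> : zpartial u = fun N => \sum_(j < m) c j * zpartial (v j) N.
  apply/funext => N; rewrite /zpartial; under eq_bigr do rewrite uE.
  by rewrite exchange_big; apply: eq_bigr => j _; rewrite mulr_sumr.
apply: (cvg_sumr (f := fun j N => c j * zpartial (v j) N)) => j.
by apply: cvgM (vl j); exact: cvg_cst.
Qed.

(** The generated field is an intersection, so the value is placed in each closed set K containing
    the generators. *)
Lemma series_field_feval (P : {poly C}) (m : nat) (r : 'I_m -> C) (e : fexpr m) :
  (forall j, root P (r j)) -> series_field P (feval r e).
Proof.
move=> Pr K [KD KS]; apply: feval_closed => // [||j|j]; apply: KS.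
- by left; left; left.
- by left; left; right.
- by left; right; exact: Pr.
- by right; exists (r j) => //; exact: Pr.
Qed.

End CotangentSeries.

(* "An explicit expression can be found": the field expressions e k and e' k
   are chosen before P, so they depend only on m and k; they give the values of
   the series for every P and every listing r of its roots. *)
Theorem theorem4p2 (R : realType) (m : nat) (hm : (1 <= m)%N) :
  exists e e' : 'I_m -> fexpr m,
  forall (P : {poly R[i]}) (r : 'I_m -> R[i]),
    P \is monic -> size P = m.+1 ->
    P = \prod_(j < m) ('X - (r j)%:P) ->
    (forall n : int, P.[n%:~R] != 0) ->
    assoc_matrix r \in unitmx ->
    (forall k : 'I_m, zsummable (zterm P k)) ->
    (forall k : 'I_m, zsummable (zterm_alt P k)) ->
  forall k : 'I_m,
    [/\ series_field P (zsum (zterm P k)),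
        series_field P (zsum (zterm_alt P k)),
        fdefined r (e k) /\ zsum (zterm P k) = feval r (e k)
      & fdefined r (e' k) /\ zsum (zterm_alt P k) = feval r (e' k)].
Proof.
pose c (j : 'I_m) (k : 'I_m) := residue_expr j k.
exists (fun k => fsum (index_enum 'I_m) (fun j => FMul (c j k) (cot_expr j))).
exists (fun k => fsum (index_enum 'I_m) (fun j => FMul (c j k) (csc_expr j))).
(* Invertibility makes the roots distinct, so every pole of x^k / P(x) is simple. *)
move=> P r _ _ PE Pn /assoc_matrix_unit_inj rI _ _ k.
have Pr j : root P (r j).
  by apply/rootP; rewrite PE horner_prod (bigD1 j)//= hornerXsubC subrr mul0r.
have rn j : nonint (r j).
  by move=> n; apply: contra (Pn n) => /eqP <-; exact: Pr.
have zE n : zterm P k n = \sum_(j < m) feval r (c j k) * (n%:~R - r j)^-1.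
  rewrite /zterm PE horner_prod; under eq_bigr do rewrite hornerXsubC.
  rewrite partial_fractions// => [|j]; last by rewrite eq_sym; exact: rn.
  by apply: eq_bigr => j _; rewrite (residue_exprP j k rI).2.
have aE n : zterm_alt P k n =
    \sum_(j < m) feval r (c j k) * ((-1) ^ n * (n%:~R - r j)^-1).
  by rewrite /zterm_alt zE mulr_sumr; apply: eq_bigr => j _; rewrite mulrCA.
have zV := zsumE (cvg_zpartial_sum zE (fun j => cvg_zpartial_inv (rn j))).
have aV := zsumE (cvg_zpartial_sum aE (fun j => cvg_zpartial_alt_inv (rn j))).
set e := fsum _ _; set e' := fsum _ _.
have eE : zsum (zterm P k) = feval r e.
  rewrite zV feval_sum; apply: eq_bigr => j _ /=.
  by rewrite -(cot_exprP (rn j)).2.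
have e'E : zsum (zterm_alt P k) = feval r e'.
  rewrite aV feval_sum; apply: eq_bigr => j _ /=.
  by rewrite -(csc_exprP (rn j)).2.
split; rewrite ?eE ?e'E; try exact: series_field_feval.
  split=> //; apply: fdefined_sum => j; split.
    exact: (residue_exprP j k rI).1.
  exact: (cot_exprP (rn j)).1.
split=> //; apply: fdefined_sum => j; split.
  exact: (residue_exprP j k rI).1.
exact: (csc_exprP (rn j)).1.
Qed.
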